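(* For each positive integer $n$, place $n$ bishops at random on the $n\times n$ chessboard, let $S_n$ be the number of safe spaces and let $\mu_n=\mathbb{E}[S_n]/n^2$ be the expected proportion of safe spaces. Then, as $n\to\infty$, $\mathbb{E}[S_n]$ is asymptotic to $2n^2/e^2$, and $\mu_n$ converges to $2/e^2$.
   Context: The $n\times n$ board is the set of spaces $\{1,\dots,n\}^2$. ''Placing $n$ pieces at random'' means that the set of occupied spaces (the board configuration) is chosen uniformly among all $\binom{n^2}{n}$ subsets of $n$ distinct spaces. A bishop at $(i,j)$ attacks every space $(x,y)$ on the board with $|x-i|=|y-j|$ (the two diagonals through $(i,j)$). A space is safe under a board configuration if it is neither occupied nor attacked by any of the placed pieces. *)

(* Defs.v *)
From HB Require Import structures.
From mathcomp Require Import all_boot all_order all_algebra.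
From mathcomp Require Import all_classical all_reals all_analysis.

Set Implicit Arguments.
Unset Strict Implicit.
Unset Printing Implicit Defensive.

Import Order.TTheory GRing.Theory Num.Theory.
Import numFieldNormedType.Exports.

Local Open Scope ring_scope.

(* Coordinates run over 0, ..., n-1 instead of 1, ..., n; the attack relation
   only involves differences of coordinates. *)
Definition space (n : nat) : finType := ('I_n * 'I_n)%type.

(* [distn] is the absolute difference: on nat, [-] alone would truncate. *)
Definition distn (a b : nat) : nat := `|a%:Z - b%:Z|%N.

(* Pieces do not block each other: a bishop attacks both full diagonals. *)
Definition bishop_attacks (n : nat) (p q : space n) : bool :=
  distn q.1 p.1 == distn q.2 p.2.

Definition configurations (n : nat) : {set {set space n}} :=
  [set B : {set space n} | #|B| == n].

Definition safe (n : nat) (B : {set space n}) (q : space n) : bool :=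
  (q \notin B) && [forall p in B, ~~ bishop_attacks p q].

Definition num_safe (n : nat) (B : {set space n}) : nat :=
  #|[set q | safe B q]|.

(* Expectation of [X] at a point drawn uniformly from [A]. *)
Definition uniform_expectation (R : realType) (T : finType) (A : {set T})
    (X : T -> R) : R :=
  \sum_(x in A) #|A|%:R^-1 * X x.

Definition expected_safe (R : realType) (n : nat) : R :=
  uniform_expectation (configurations n) (fun B => (num_safe B)%:R).

(* At [n = 0] this is [0 / 0 = 0]; only [n > 0] is meaningful. *)
Definition expected_safe_proportion (R : realType) (n : nat) : R :=
  expected_safe R n / n%:R ^+ 2.

Lemma card_configurations (n : nat) : #|configurations n| = 'C(n ^ 2, n).
Proof. by rewrite card_draws card_prod card_ord mulnn. Qed.

(* Main.v *)
(** By linearity E[S_n] is the sum over spaces q of C(n^2 - d, n) / C(n^2, n),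
    where d is the number of spaces on the two diagonals through q.  This number
    is n + 2k when q lies at distance k from the border, and the ring at
    distance k has 4 (n - 1 - 2k) spaces (a single one at an odd centre).
    The ratio of binomials is e^(-d/n) up to a factor e^(O(1/n)), so with
    y = (n - 1 - 2k) / n the proportion is
    2 e^(-2) times a Riemann sum (step 2/n) of y e^y on [0, 1], up to O(1/n).
    The integral of y e^y over [0, 1] is 1. *)
Require Import Defs.
From HB Require Import structures.
From mathcomp Require Import all_boot all_order all_algebra.
From mathcomp Require Import all_classical all_reals all_analysis.
From mathcomp Require Import zify ring lra.
Import Order.TTheory GRing.Theory Num.Theory.
Import numFieldNormedType.Exports.
Local Open Scope classical_set_scope.
Local Open Scope ring_scope.

(** * Counting diagonals and concentric rings of the board *)

Lemma card_ord_interval (n a b : nat) :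
  #|[set x : 'I_n | (a <= x < b)%N]%SET| = (minn b n - a)%N.
Proof.
rewrite -sum1dep_card -(big_mkord (fun x => a <= x < b)%N (fun=> 1%N)).
elim: n => [|n IH]; first by rewrite big_nil; lia.
by rewrite big_mkcond big_nat_recr //= -big_mkcond IH /=; case: ifP; lia.
Qed.

(** The space [q] itself belongs to this set, so [q] is safe exactly when no piece lies in it. *)
Definition attackers {n} (q : Defs.space n) : {set Defs.space n} :=
  [set p | bishop_attacks p q]%SET.

(** Equality of coordinate differences, written with sums because subtraction on [nat] truncates. *)
Definition diag {n} (q : Defs.space n) : {set Defs.space n} :=
  [set p : Defs.space n | p.1 + q.2 == p.2 + q.1 :> nat]%N%SET.

Definition antidiag {n} (q : Defs.space n) : {set Defs.space n} :=
  [set p : Defs.space n | p.1 + p.2 == q.1 + q.2 :> nat]%N%SET.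

(* The distance from [q] to the border of the board. *)
Definition level {n} (q : Defs.space n) : nat :=
  minn (minn q.1 q.2) (minn (n.-1 - q.1) (n.-1 - q.2)).

Lemma attackersE n (q : Defs.space n) : attackers q = (diag q :|: antidiag q)%SET.
Proof.
apply/setP => p; rewrite !inE /bishop_attacks /distn.
by case: p q => [[a ?] [b ?]] [[c ?] [d ?]] /=; lia.
Qed.

Lemma diagI n (q : Defs.space n) : (diag q :&: antidiag q)%SET = [set q]%SET.
Proof.
apply/setP => p; rewrite !inE.
case: p q => [[a ?] [b ?]] [[c ?] [d ?]] /=.
by rewrite xpair_eqE -!val_eqE /=; lia.
Qed.

(** The first coordinate maps the diagonal injectively onto the integers of
    [[q.1 - q.2, n + q.1 - q.2)] that lie in [[0, n)]. *)
Lemma card_diag n (q : Defs.space n) :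
  #|diag q| = (minn (n + q.1 - q.2) n - (q.1 - q.2))%N.
Proof.
have inj : {in diag q &, injective fst}.
  move=> [x y] [x' y']; rewrite !inE /= => h h' e; subst x'.
  by congr pair; apply: val_inj => /=; lia.
rewrite -(card_in_imset inj) -card_ord_interval; apply: eq_card => x.
rewrite inE; apply/imsetP/idP.
  move=> [[x' y]]; rewrite inE /= => h ->.
  by have := ltn_ord y; lia.
case: q x {inj} => [[i hi] [j hj]] [x hx] /= h.
have hy : (x + j - i < n)%N by lia.
by exists (Ordinal hx, Ordinal hy) => //; rewrite inE /=; lia.
Qed.

Lemma card_antidiag n (q : Defs.space n) :
  #|antidiag q| = (minn (q.1 + q.2).+1 n - ((q.1 + q.2).+1 - n))%N.
Proof.
have inj : {in antidiag q &, injective fst}.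
  move=> [x y] [x' y']; rewrite !inE /= => h h' e; subst x'.
  by congr pair; apply: val_inj => /=; lia.
rewrite -(card_in_imset inj) -card_ord_interval; apply: eq_card => x.
rewrite inE; apply/imsetP/idP.
  move=> [[x' y]]; rewrite inE /= => h ->.
  by have := ltn_ord y; lia.
case: q x {inj} => [[i hi] [j hj]] [x hx] /= h.
have hy : (i + j - x < n)%N by lia.
by exists (Ordinal hx, Ordinal hy) => //; rewrite inE /=; lia.
Qed.

Lemma card_attackers n (q : Defs.space n) : #|attackers q| = (n + (level q).*2)%N.
Proof.
rewrite attackersE cardsU diagI cards1 card_diag card_antidiag /level.
case: q => [[i hi] [j hj]] /=.
(* The two main diagonals cut the board into four triangles; in each one the nearest side is known,
   so every minimum resolves and the claim becomes linear. *)
have [ij|ji] := leqP i j; have [lo|up] := leqP (i + j).+1 n.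
- have -> : minn (n.-1 - i) (n.-1 - j) = (n.-1 - j)%N by lia.
  have -> : minn i (n.-1 - j) = i by lia.
  have -> : (minn (n + i - j) n - (i - j) = n - (j - i))%N by lia.
  have -> : ((i + j).+1 - ((i + j).+1 - n) = (i + j).+1)%N by lia.
  by lia.
- have -> : minn (n.-1 - i) (n.-1 - j) = (n.-1 - j)%N by lia.
  have -> : minn i (n.-1 - j) = (n.-1 - j)%N by lia.
  have -> : (minn (n + i - j) n - (i - j) = n - (j - i))%N by lia.
  have -> : (n - ((i + j).+1 - n) = n.*2 - (i + j).+1)%N by lia.
  by lia.
- have -> : minn (n.-1 - i) (n.-1 - j) = (n.-1 - i)%N by lia.
  have -> : minn j (n.-1 - i) = j by lia.
  have -> : (minn (n + i - j) n - (i - j) = n - (i - j))%N by lia.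
  have -> : ((i + j).+1 - ((i + j).+1 - n) = (i + j).+1)%N by lia.
  by lia.
- have -> : minn (n.-1 - i) (n.-1 - j) = (n.-1 - i)%N by lia.
  have -> : minn j (n.-1 - i) = (n.-1 - i)%N by lia.
  have -> : (minn (n + i - j) n - (i - j) = n - (i - j))%N by lia.
  have -> : (n - ((i + j).+1 - n) = n.*2 - (i + j).+1)%N by lia.
  by lia.
Qed.

(** These spaces form the central square of side [n - 2k]; truncated subtraction covers the empty
    case. *)
Lemma card_level_ge n k :
  #|[set q : Defs.space n | (k <= level q)%N]%SET| = ((n - k.*2) ^ 2)%N.
Proof.
have -> : [set q : Defs.space n | (k <= level q)%N]%SET =
    finset.setX [set x : 'I_n | (k <= x < n - k)%N]%SET
                [set x : 'I_n | (k <= x < n - k)%N]%SET.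
  apply/setP => -[[x hx] [y hy]]; rewrite !inE /level /=; lia.
rewrite cardsX card_ord_interval -mulnn; congr muln; lia.
Qed.

Lemma card_level n k :
  #|[set q : Defs.space n | level q == k]%SET| =
  ((n - k.*2) ^ 2 - (n - k.+1.*2) ^ 2)%N.
Proof.
rewrite -!card_level_ge -cardsDS; last first.
  by apply/fintype.subsetP => q; rewrite !inE; lia.
by apply: eq_card => q; rewrite !inE; lia.
Qed.

(** * The expectation as a sum over rings *)

Lemma card_safe_configurations n (q : Defs.space n) :
  #|[set B in configurations n | safe B q]%SET| =
  'C(n ^ 2 - (n + (level q).*2), n).
Proof.
have -> : (n ^ 2 - (n + (level q).*2))%N = #|(~: attackers q)%SET|.
  by rewrite -card_attackers [RHS]cardsCs finset.setCK card_prod card_ord mulnn.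
rewrite -cards_draws; apply: eq_card => B.
rewrite !inE andbC; congr andb; rewrite /safe; apply/idP/idP.
  move=> /andP[_ /forall_inP h]; apply/fintype.subsetP => p pB.
  by rewrite !inE h.
move=> /fintype.subsetP h; apply/andP; split.
  by apply/negP => /h; rewrite !inE /bishop_attacks /distn; lia.
by apply/forall_inP => p /h; rewrite !inE.
Qed.

Lemma expected_safeE (R : realType) n :
  expected_safe R n = \sum_(q : Defs.space n)
    'C(n ^ 2 - (n + (level q).*2), n)%:R / 'C(n ^ 2, n)%:R.
Proof.
rewrite /expected_safe /uniform_expectation card_configurations -mulr_sumr.
rewrite -mulr_suml mulrC; congr (_ / _).
rewrite -!natr_sum; congr (_%:R).
under eq_bigr do rewrite /num_safe -sum1dep_card big_mkcond.
rewrite exchange_big /=; apply: eq_bigr => q _.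
rewrite -big_mkcondr sum1dep_card -card_safe_configurations.
by apply: eq_card => B; rewrite !inE.
Qed.

Lemma sum_level (R : realType) n (g : nat -> R) :
  \sum_(q : Defs.space n) g (level q) =
  \sum_(k < n./2) 4 * (n%:R - 1 - 2 * k%:R) * g k + (odd n)%:R * g n./2.
Proof.
have lt_level (q : Defs.space n) : (level q < n./2.+1)%N.
  by rewrite /level; have := ltn_ord q.1; have := ltn_ord q.2; lia.
rewrite (partition_big (fun q => Ordinal (lt_level q)) xpredT) //=.
under eq_bigr => k _.
  rewrite (eq_bigr (fun=> g k)); last by move=> q /eqP <-.
  rewrite sumr_const.
  rewrite (_ : #|_| = ((n - k.*2) ^ 2 - (n - k.+1.*2) ^ 2)%N); last first.
    by rewrite -card_level; apply: eq_card => q; rewrite !inE.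
  rewrite -mulr_natl.
  over.
(* The last index [n./2] is the centre: one space when [n] is odd, none when [n] is even. *)
rewrite big_ord_recr /=; congr (_ + _).
  apply: eq_bigr => -[k hk] _ /=; congr (_ * _).
  (* With [m = n - 2k - 2], a natural number since [k < n./2], this is
     [(m + 2)^2 - m^2 = 4 (m + 1)]. *)
  have -> : ((n - k.*2) ^ 2 - (n - k.+1.*2) ^ 2 = 4 * (n - 1 - 2 * k))%N.
    have -> : (n - k.*2 = n - k.+1.*2 + 2)%N by lia.
    have -> : (n - 1 - 2 * k = n - k.+1.*2 + 1)%N by lia.
    by rewrite sqrnD; lia.
  by rewrite natrM !natrB ?natrM //; lia.
congr (_%:R * _); rewrite -!mulnn; have := odd_double_half n.
by case: odd; nia.
Qed.

(** * Exponential bounds for the ratio of binomials *)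

Lemma bin_ratioE (R : realType) (N d n : nat) : (n <= N)%N ->
  'C(N - d, n)%:R / 'C(N, n)%:R =
  \prod_(i < n) ((N - d - i)%:R / (N - i)%:R) :> R.
Proof.
move=> nN; rewrite prodf_div -!natr_prod -!ffact_prod -!bin_ffact !natrM.
by rewrite -mulf_div divff ?mulr1 // pnatr_eq0 -lt0n fact_gt0.
Qed.

(** Each factor [(N - d - i) / (N - i)] is at most [1 - d / N], hence at most [e^(-d/N)]. *)
Lemma bin_ratio_le (R : realType) (N d n : nat) : (n <= N)%N -> (d <= N)%N ->
  'C(N - d, n)%:R / 'C(N, n)%:R <= expR (- (n%:R * d%:R / N%:R)) :> R.
Proof.
move=> nN dN; rewrite bin_ratioE // -mulrA -mulrN expRM_natl -[n in _ ^+ n]card_ord.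
rewrite -prodr_const; apply: ler_prod => -[i iltn] _ /=.
rewrite divr_ge0 //=; apply: le_trans (expR_ge1Dx _).
have N0 : 0 < N%:R :> R by rewrite ltr0n; lia.
rewrite ler_pdivrMr ?ltr0n; last by lia.
rewrite -(ler_pM2r N0) mulrAC mulrDl mul1r mulNr divfK ?gt_eqF //.
by rewrite -natrB // -!natrM ler_nat; nia.
Qed.

(** The inverse of each factor is [1 + d / (N - d - i)], at most [1 + d / (N - n - d)], which is
    bounded by the exponential of [d / (N - n - d)]. *)
Lemma bin_ratio_ge (R : realType) (N d n : nat) : (n + d < N)%N ->
  expR (- (n%:R * d%:R / (N - n - d)%:R)) <=
  'C(N - d, n)%:R / 'C(N, n)%:R :> R.
Proof.
move=> nN; rewrite bin_ratioE; last by lia.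
rewrite -mulrA -mulrN expRM_natl -[n in _ ^+ n]card_ord.
rewrite -prodr_const; apply: ler_prod => -[i iltn] _ /=.
rewrite expR_ge0 /= expRN -[leRHS]invrK lef_pV2 ?posrE ?expR_gt0 //; last first.
  by rewrite invr_gt0 divr_gt0 ?ltr0n; lia.
rewrite invf_div; apply: le_trans (expR_ge1Dx _).
have p1 : 0 < (N - d - i)%:R :> R by rewrite ltr0n; lia.
have -> : (N - i)%:R = (N - d - i)%:R + d%:R :> R by rewrite -natrD; congr _%:R; lia.
rewrite mulrDl divff ?gt_eqF // lerD2l ler_wpM2l //.
by rewrite lef_pV2 ?posrE ?ltr0n ?ler_nat; lia.
Qed.

(** * Riemann sums of [y e^y] *)

(** An antiderivative of [x e^x], with values -1 at 0 and 0 at 1. *)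
Definition xexp_primitive {R : realType} (x : R) : R := (x - 1) * expR x.

(* Dividing by [expR y], the difference of the two sides is
   [y * (expR t - 1 - t) + expR t * (expR (- t) - 1 + t)]; [t] may be negative,
   which gives both the lower and the upper Riemann sum bounds. *)
Lemma xexp_primitive_ge (R : realType) (y t : R) : 0 <= y ->
  t * (y * expR y) <= xexp_primitive (y + t) - xexp_primitive y.
Proof.
move=> y0; rewrite /xexp_primitive expRD -subr_ge0.
have h1 : 0 <= expR t - (1 + t) by rewrite subr_ge0 expR_ge1Dx.
have h2 : 0 <= expR t * (expR (- t) - (1 - t)).
  by rewrite mulr_ge0 ?expR_ge0 // subr_ge0 expR_ge1Dx.
have -> : (y + t - 1) * (expR y * expR t) - (y - 1) * expR y - t * (y * expR y)
   = expR y * (y * (expR t - (1 + t)) + expR t * (expR (- t) - (1 - t))).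
  by rewrite expRN; field; rewrite gt_eqF // expR_gt0.
by rewrite mulr_ge0 ?expR_ge0 // addr_ge0 // mulr_ge0.
Qed.

(** The points [y k] decrease from [1 - h] by steps [2 h]. Each term is at least the increment of
    the primitive over [[y k - 2h, y k]] and at most that over [[y k, y k + 2h]]; both families
    telescope. *)
Lemma riemann_sum_xexp (R : realType) (n : nat) (h : R := n%:R^-1)
    (y : nat -> R := fun k => (n%:R - 1 - 2 * k%:R) / n%:R) : (0 < n)%N ->
  expR (- h) - h * expR (1 - h) <=
    \sum_(k < n./2) 2 * h * (y k * expR (y k)) <= 1 + h * expR (1 + h).
Proof.
move=> n0; set K := n./2.
have n0R : 0 < n%:R :> R by rewrite ltr0n.
have nN0 : n%:R != 0 :> R by rewrite gt_eqF.
have y0 k : (k < K)%N -> 0 <= y k.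
  move=> kK; rewrite divr_ge0 // ?ler0n //.
  have : (k.*2 + 1)%:R <= n%:R :> R by rewrite ler_nat; lia.
  by rewrite natrD -mul2n natrM; lra.
have yS k : y k.+1 = y k - 2 * h by rewrite /y /h -natr1; field.
have tele (f : nat -> R) : \sum_(k < K) (f k - f k.+1) = f 0%N - f K.
  rewrite -opprB -telescope_sumr // big_mkord -sumrN.
  by apply: eq_bigr => k _; rewrite opprB.
apply/andP; split.
- apply: (@le_trans _ _ (xexp_primitive (y 0%N) - xexp_primitive (y K))).
    have -> : y 0%N = 1 - h by rewrite /y /h; field.
    rewrite /xexp_primitive.
    have -> : 1 - h - 1 = - h by ring.
    suff : (y K - 1) * expR (y K) <= - expR (- h) by lra.
    have hn : n%:R = (odd n)%:R + 2 * K%:R :> R.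
      by rewrite -natrM -natrD mul2n odd_double_half.
    (* The end point is 0 for odd [n] and [-h] for even [n]. *)
    have -> : y K = ((odd n)%:R - 1) * h by rewrite /y /h {1}hn; field.
    have h0 : 0 <= h by rewrite invr_ge0 ltW.
    case: odd; rewrite ?subrr ?mul0r ?sub0r ?mulN1r ?expR0 /=.
      by rewrite lerN2 -expR0 ler_expR oppr_le0.
    by have := expR_ge0 (- h); nra.
  rewrite -(tele (fun k => xexp_primitive (y k))); apply: ler_sum => k _.
  have := @xexp_primitive_ge R (y k) (- (2 * h)) (y0 _ (ltn_ord k)).
  by rewrite yS; lra.
- apply: (@le_trans _ _
    (xexp_primitive (y 0%N + 2 * h) - xexp_primitive (y K + 2 * h))).
    rewrite -(tele (fun k => xexp_primitive (y k + 2 * h))).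
    apply: ler_sum => k _.
    have := @xexp_primitive_ge R (y k) (2 * h) (y0 _ (ltn_ord k)).
    by rewrite yS subrK; lra.
  have -> : y 0%N + 2 * h = 1 + h by rewrite /y /h; field.
  (* Taken at [y = 0], the inequality says that the primitive is at least -1 everywhere. *)
  have := @xexp_primitive_ge R 0 (y K + 2 * h) (lexx _).
  rewrite mul0r mulr0 add0r /xexp_primitive expR0; lra.
Qed.

(** * Explicit bounds on the proportion *)

(** With [N = n^2] and [d = n + 2k], [n d / N] equals [2 - h - y k], so the binomial ratio is
    [e^(y k - 2)] up to a factor [e^(O(h))], and the sum over rings reduces to the Riemann sum. *)
Lemma expected_safe_proportion_bounds (R : realType) (n : nat)
    (h : R := n%:R^-1) : (6 <= n)%N ->
  2 * expR (- 11 * h - 2) * (expR (- h) - h * expR (1 - h)) <=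
    expected_safe_proportion R n <=
  2 * expR (h - 2) * (1 + h * expR (1 + h)) + h ^+ 2.
Proof.
move=> n6.
have n0R : 0 < n%:R :> R by rewrite ltr0n; lia.
have nN0 : n%:R != 0 :> R by rewrite gt_eqF.
set y := fun k : nat => (n%:R - 1 - 2 * k%:R) / n%:R : R.
pose p k : R := 'C(n ^ 2 - (n + k.*2), n)%:R / 'C(n ^ 2, n)%:R.
have n0 : (0 < n)%N by lia.
have /andP[sum_ge sum_le] := riemann_sum_xexp R n n0.
have dist k : 1 + 2 * k%:R / n%:R = 2 - h - y k :> R by rewrite /y /h; field.
have p_le k : (k.*2 <= n)%N -> p k <= expR (h - 2) * expR (y k).
  move=> kn; apply: le_trans (@bin_ratio_le _ _ _ _ _ _) _; try nia.
  rewrite -expRD ler_expR natrX natrD -mul2n natrM.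
  have -> : n%:R * (n%:R + 2 * k%:R) / n%:R ^+ 2 = 1 + 2 * k%:R / n%:R :> R.
    by field.
  by rewrite dist; lra.
have p_ge k : (k.*2 <= n)%N -> expR (- 11 * h - 2) * expR (y k) <= p k.
  move=> kn; apply: le_trans (@bin_ratio_ge _ _ _ _ _); last by nia.
  rewrite -expRD ler_expR.
  (* With [d = n + 2k] this amounts to [(d + 12) (n + d) <= 12 n^2]. As [d <= 2n], the left side is
     at most [6 n^2 + 36 n], whence the condition [6 <= n]. The 11 in the bound is this 12 minus the
     1 from [dist]. *)
  suff : n%:R * (n + k.*2)%:R / (n ^ 2 - n - (n + k.*2))%:R
      <= (n + k.*2 + 12)%:R / n%:R :> R.
    have -> : (n + k.*2 + 12)%:R / n%:R = 2 - h - y k + 12 * h.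
      by rewrite -dist !natrD -mul2n natrM /h; field.
    by lra.
  rewrite ler_pdivrMr ?ltr0n; last by nia.
  rewrite mulrAC ler_pdivlMr // -!natrM ler_nat.
  by have : (n ^ 2 - n - (n + k.*2) + n + (n + k.*2) = n ^ 2)%N; nia.
have -> : expected_safe_proportion R n =
    \sum_(k < n./2) 2 * (2 * h * y k) * p k + (odd n)%:R * p n./2 * h ^+ 2.
  rewrite /expected_safe_proportion expected_safeE (sum_level R n p) mulrDl.
  rewrite -exprVn; congr (_ + _); rewrite mulr_suml; apply: eq_bigr => k _.
  by rewrite /y /h; field.
have c0 k : (k < n./2)%N -> 0 <= 2 * (2 * h * y k).
  move=> kK; rewrite !mulr_ge0 // ?invr_ge0 ?ler0n //.
  have : (k.*2 + 1)%:R <= n%:R :> R by rewrite ler_nat; lia.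
  by rewrite natrD -mul2n natrM; lra.
apply/andP; split.
- apply: le_trans (ler_wpM2l _ sum_ge) _; first by rewrite mulr_ge0 ?expR_ge0.
  rewrite mulr_sumr -[leLHS]addr0 lerD //.
    apply: ler_sum => k _.
    have := ler_wpM2l (c0 k (ltn_ord k)) (p_ge k _); rewrite -/(y k) -/h.
    have -> : (k.*2 <= n)%N by have := ltn_ord k; lia.
    move=> /(_ isT); apply: le_trans.
    by rewrite le_eqVlt; apply/orP; left; apply/eqP; ring.
  by rewrite !mulr_ge0 ?exprn_ge0 ?invr_ge0 ?ler0n // divr_ge0.
(* The centre contributes at most [h^2], its binomial ratio being at most 1. *)
- apply: lerD; last first.
    rewrite ler_piMl ?exprn_ge0 ?invr_ge0 ?ler0n // -[leRHS]mulr1.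
    apply: ler_pM => //; rewrite ?divr_ge0 //; first by case: odd.
    rewrite /p ler_pdivrMr ?mul1r ?ltr0n ?bin_gt0; last by nia.
    by rewrite ler_nat leq_bin2l // leq_subr.
  apply: le_trans _ (ler_wpM2l _ sum_le); last by rewrite mulr_ge0 ?expR_ge0.
  rewrite mulr_sumr; apply: ler_sum => k _.
  have := ler_wpM2l (c0 k (ltn_ord k)) (p_le k _); rewrite -/(y k) -/h.
  have -> : (k.*2 <= n)%N by have := ltn_ord k; lia.
  move=> /(_ isT) /le_trans; apply.
  by rewrite le_eqVlt; apply/orP; left; apply/eqP; ring.
Qed.

(** * Passage to the limit *)

Theorem theorem1p2 (R : realType) :
  ((fun n : nat => expected_safe R n : R^o) ~_\oo
     (fun n : nat => 2 * n%:R ^+ 2 / expR 1 ^+ 2 : R^o)) /\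
  (expected_safe_proportion R n @[n --> \oo] --> 2 / expR 1 ^+ 2).
Proof.
have e2 : 2 / expR 1 ^+ 2 = 2 * expR (- 2) :> R.
  by rewrite expRN -expRM_natl mulr1.
have cvg_h : (n%:R^-1 : R) @[n --> \oo] --> (0 : R).
  by rewrite -(cvg_shiftS (fun n => n%:R^-1 : R)); exact: cvg_harmonic.
have ce (a b : R) : expR (a * n%:R^-1 + b) @[n --> \oo] --> expR b.
  have lin : a * n%:R^-1 + b @[n --> \oo] --> a * 0 + b.
    by apply: cvgD; [apply: cvgMr|exact: cvg_cst].
  by rewrite mulr0 add0r in lin; exact: cvg_comp lin (@continuous_expR R b).
have main : expected_safe_proportion R n @[n --> \oo] --> 2 / expR 1 ^+ 2.
  (* The exponents are padded to the shape [a * n^-1 + b] so that [ce] gives all their limits. *)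
  apply: (@squeeze_cvgr _ _ _ _
    (fun n : nat => 2 * expR (- 11 * n%:R^-1 - 2) *
       (expR (- 1 * n%:R^-1 + 0) - n%:R^-1 * expR (- 1 * n%:R^-1 + 1)))
    (fun n : nat => 2 * expR (1 * n%:R^-1 - 2) *
       (1 + n%:R^-1 * expR (1 * n%:R^-1 + 1)) + n%:R^-1 ^+ 2)).
  - near=> n; have := @expected_safe_proportion_bounds R n.
    rewrite !mul1r addr0 !mulN1r (addrC (- n%:R^-1) 1) (addrC n%:R^-1 1); apply.
    by near: n; exact: nbhs_infty_ge.
  - rewrite e2 (_ : 2 * _ = 2 * expR (- 2) * (expR 0 - 0 * expR 1)).
      by apply: cvgM; [apply: cvgMr; exact: ce|apply: cvgB => //; apply: cvgM].
    by rewrite expR0; ring.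
  - rewrite e2 (_ : 2 * _ = 2 * expR (- 2) * (1 + 0 * expR 1) + 0 * 0); last by ring.
    apply: cvgD; last exact: cvgM.
    apply: cvgM; [by apply: cvgMr; exact: ce|apply: cvgD; [exact: cvg_cst|]].
    by apply: cvgM.
(* Equivalence asks for a relative error [eps]: with [c = 2 / e^2], use the limit with tolerance
   [eps * c] and multiply by [n^2]. *)
split=> //; apply/eqaddoP => eps eps0.
have c0 : 0 < 2 / expR 1 ^+ 2 :> R by rewrite divr_gt0 ?exprn_gt0 ?expR_gt0.
move/cvgrPdist_le: main => /(_ (eps * (2 / expR 1 ^+ 2)) (mulr_gt0 eps0 c0)) main.
near=> n.
have n0 : 0 < n%:R :> R by rewrite ltr0n; near: n; exact: nbhs_infty_gt.
have : `|2 / expR 1 ^+ 2 - expected_safe_proportion R n| <= eps * (2 / expR 1 ^+ 2).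
  by near: n.
rewrite /expected_safe_proportion distrC => h.
have -> : (2 * n%:R ^+ 2 / expR 1 ^+ 2 : R^o) = (2 / expR 1 ^+ 2) * n%:R ^+ 2 :> R.
  by rewrite mulrAC.
rewrite [in leRHS]normrM (gtr0_norm c0) mulrA (ger0_norm (sqr_ge0 _)).
have := ler_wpM2r (sqr_ge0 (n%:R : R)) h; apply: le_trans.
rewrite -[X in _ * X](ger0_norm (sqr_ge0 (n%:R : R))) -normrM mulrBl.
by rewrite divfK ?expf_neq0 ?gt_eqF // mulrAC.
Unshelve. all: by end_near.
Qed.
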